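(* Let $G$ be a graph and $\theta$ a real number with $\mathrm{mult}(\theta,G)\ge2$, and let $H_1,\dots,H_q$ be the $\theta$-critical components of $G\setminus A_\theta(G)$. For distinct vertices $u,v$, $\mathrm{mult}(\theta,S_\theta(G)\setminus\{u,v\})=\mathrm{mult}(\theta,S_\theta(G))-2$ if and only if $u\in V(H_i)$ and $v\in V(H_j)$ for some $i\neq j$.
   Context: All graphs are finite and simple. For a graph $G$ on $n$ vertices, let $p(G,r)$ be the number of $r$-matchings of $G$ ($p(G,0)=1$); the matching polynomial is $\mu(G,x)=\sum_{r=0}^{\lfloor n/2\rfloor}(-1)^r p(G,r)x^{n-2r}$. For real $\theta$, $\mathrm{mult}(\theta,G)$ is the multiplicity of $\theta$ as a root of $\mu(G,x)$. $G\setminus X$ denotes deletion of the vertex set $X$; $G\setminus u=G\setminus\{u\}$. A vertex $u$ is $\theta$-essential in $G$ if $\mathrm{mult}(\theta,G\setminus u)=\mathrm{mult}(\theta,G)-1$. A vertex is $\theta$-special if it is not $\theta$-essential but is adjacent to a $\theta$-essential vertex; $A_\theta(G)$ is the set of $\theta$-special vertices. A connected graph is $\theta$-critical if all its vertices are $\theta$-essential in it. $S_\theta(G)$ is the graph on $V(G)$ whose edges are the edges of $G$ together with all pairs $\{w,z\}$, $z\neq w$, with $w\in A_\theta(G)$. *)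

(* Defs.v *)
From HB Require Import structures.
From mathcomp Require Import all_boot all_order all_algebra.
Set Implicit Arguments. Unset Strict Implicit. Unset Printing Implicit Defensive.
Import Order.TTheory GRing.Theory Num.Theory.

(* A (simple) graph is a relation [e : rel T] on a finite type T (assumed
   symmetric and irreflexive in the theorem).  For a vertex set S : {set T},
   G[S] denotes the induced subgraph; G \ X is G[~: X]. *)

Section Graphs.
Variable T : finType.

Definition is_matching (e : rel T) (S : {set T}) (M : {set {set T}}) : bool :=
  [forall m in M, exists a, exists b,
      [&& a \in S, b \in S, e a b & m == [set a; b]]] &&
  [forall m1 in M, forall m2 in M, (m1 != m2) ==> [disjoint m1 & m2]].

Definition nmatch (e : rel T) (S : {set T}) (r : nat) : nat :=
  #|[set M : {set {set T}} | is_matching e S M & #|M| == r]|.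

Definition mpoly (R : nzRingType) (e : rel T) (S : {set T}) : {poly R} :=
  \sum_(r < (#|S|./2).+1)
     (((-1) ^+ r * (nmatch e S r)%:R) *: 'X^(#|S| - 2 * r)).

Definition mult (R : fieldType) (theta : R) (e : rel T) (S : {set T}) : nat :=
  mup theta (mpoly R e S).

Definition essential (R : fieldType) (theta : R) (e : rel T) (S : {set T})
    (u : T) : bool :=
  (u \in S) && ((mult theta e (S :\ u)).+1 == mult theta e S).

Definition special (R : fieldType) (theta : R) (e : rel T) (S : {set T})
    (u : T) : bool :=
  [&& u \in S, ~~ essential theta e S u &
      [exists w in S, e u w && essential theta e S w]].

Definition Aset (R : fieldType) (theta : R) (e : rel T) : {set T} :=
  [set u | special theta e setT u].

Definition Srel (R : fieldType) (theta : R) (e : rel T) : rel T :=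
  [rel x y | e x y || ((x != y) &&
      ((x \in Aset theta e) || (y \in Aset theta e)))].

Definition induced (e : rel T) (S : {set T}) : rel T :=
  [rel x y | [&& x \in S, y \in S & e x y]].

Definition comp (e : rel T) (S : {set T}) (u : T) : {set T} :=
  [set v in S | connect (induced e S) u v].

Definition is_component (e : rel T) (S : {set T}) (H : {set T}) : bool :=
  [exists u in S, H == comp e S u].

Definition critical (R : fieldType) (theta : R) (e : rel T) (H : {set T}) : bool :=
  [&& H != set0,
      [forall u in H, forall v in H, connect (induced e H) u v] &
      [forall u in H, essential theta e H u]].

End Graphs.

(* Main.v *)
Require Import Defs.
From HB Require Import structures.
From mathcomp Require Import all_boot all_order all_algebra.
From mathcomp Require Import ring zify.
Import Order.TTheory GRing.Theory Num.Theory.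
Set Implicit Arguments. Unset Strict Implicit. Unset Printing Implicit Defensive.
Local Open Scope ring_scope.

(* Write m(S) for the multiplicity of theta in G[S].  The Heilmann-Lieb identity
   makes mu(S-u) mu(S-w) - mu(S) mu(S-u-w) a sum of squares; hence its order at
   theta is even, m changes by at most 1 when a vertex is deleted, and the lowest
   coefficients at theta of mu(S-u) and mu(S) have the same sign when u is
   essential in S.  The sets X with m(S-X) = m(S) - |X| are the independent sets
   of a matroid whose non-loops are the essential vertices; only ranks 1 and 2
   are needed.  Adjacent essential vertices are dependent, and dependence of
   essential vertices is transitive.  If a is special, mu(S) and -sum_(y ~ a)
   mu(S-a-y) agree to lowest order and no cancellation occurs, so deleting a
   raises m by 1 and, by transitivity of dependence, preserves the essential
   vertices.  Deleting all of A therefore leaves a graph U without special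
   vertices, in which two vertices are independent iff they lie in different
   critical components.  Adding a universal vertex to a graph with m > 0 lowers m
   by 1, and it preserves independence of pairs as long as the resulting m is at
   least 2; adding the vertices of A back to U gives the theorem. *)

(** * Matchings as sets of edges, and the recurrence of the matching polynomial *)

Section MatchingPolynomial.
Variables (T : finType) (e : rel T).
Hypotheses (e_sym : symmetric e) (e_irr : irreflexive e).
Implicit Types (S : {set T}) (M : {set {set T}}) (u w : T).

Definition edge_in S (m : {set T}) :=
  exists a b, [/\ a \in S, b \in S, e a b & m = [set a; b]].

Lemma is_matchingP S M :
  reflect ((forall m, m \in M -> edge_in S m) /\ trivIset M) (is_matching e S M).
Proof.
apply: (iffP andP) => -[hE hT]; split.
- move=> m mM; move/forallP/(_ m)/implyP/(_ mM)/existsP: hE => [a /existsP[b]].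
  by case/and4P=> ? ? ? /eqP ->; exists a, b.
- apply/trivIsetP => m1 m2 m1M m2M ne.
  by move/forallP/(_ m1)/implyP/(_ m1M)/forallP/(_ m2)/implyP/(_ m2M)/implyP: hT; apply.
- apply/forallP => m; apply/implyP => /hE [a [b [? ? ? ->]]].
  by apply/existsP; exists a; apply/existsP; exists b; apply/and4P.
- apply/forallP => m1; apply/implyP => m1M; apply/forallP => m2; apply/implyP => m2M.
  by apply/implyP => ne; exact: (trivIsetP hT).
Qed.

Lemma edge_in_ends S u w : edge_in S [set u; w] -> [/\ u \in S, w \in S & e u w].
Proof.
move=> [a [b [aS bS eab E]]].
have ua : u \in [set a; b] by rewrite -E set21.
have wa : w \in [set a; b] by rewrite -E set22.
have aw : a \in [set u; w] by rewrite E set21.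
have bw : b \in [set u; w] by rewrite E set22.
case/set2P: ua => ?; case/set2P: wa => ?; subst => //.
- by case/set2P: bw => ?; subst; rewrite e_irr in eab.
- by rewrite e_sym.
- by case/set2P: aw => ?; subst; rewrite e_irr in eab.
Qed.

Lemma edge_in_other S m u : edge_in S m -> u \in m ->
  exists2 w, m = [set u; w] & e u w.
Proof.
move=> [a [b [aS bS eab ->]]] /set2P [] ->; first by exists b.
by exists a; rewrite 1?setUC 1?e_sym.
Qed.

Lemma edge_in_sub S S' m : edge_in S m -> m \subset S' -> edge_in S' m.
Proof.
move=> [a [b [aS bS eab ->]]] /subsetP sub; exists a, b.
by split; rewrite ?sub ?set21 ?set22.
Qed.

Lemma edge_in_subset S m : edge_in S m -> m \subset S.
Proof. by move=> [a [b [aS bS _ ->]]]; apply/subsetP => x /set2P [] ->. Qed.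

Lemma edge_in_card S m : edge_in S m -> #|m| = 2.
Proof.
move=> [a [b [aS bS eab ->]]]; rewrite cards2; case: eqP eab => // ->.
by rewrite e_irr.
Qed.

Lemma cover_matching S M : is_matching e S M -> cover M \subset S.
Proof.
by move=> /is_matchingP [hE _]; apply/bigcupsP => m /hE /edge_in_subset.
Qed.

Lemma card_matching S M : is_matching e S M -> (2 * #|M| <= #|S|)%N.
Proof.
move=> hM; rewrite mulnC; have /is_matchingP [hE hT] := hM.
have := hT; rewrite /trivIset => /eqP.
rewrite (eq_bigr (fun=> 2)) => [|m /hE /edge_in_card //].
by rewrite sum_nat_const => ->; apply/subset_leq_card/cover_matching.
Qed.

Lemma is_matching_avoid S M u :
  is_matching e S M && (u \notin cover M) = is_matching e (S :\ u) M.
Proof.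
apply/andP/idP => [[/is_matchingP [hE hT] uM]|hM].
  apply/is_matchingP; split=> // m mM; have sub := edge_in_subset (hE m mM).
  apply: (edge_in_sub (hE m mM)); apply/subsetD1P; split=> //.
  by apply: contraNN uM => um; apply/bigcupP; exists m.
have sub := cover_matching hM; split; last first.
  by apply/negP => /(subsetP sub); rewrite !inE eqxx.
have /is_matchingP [hE hT] := hM; apply/is_matchingP; split=> // m mM.
apply: (edge_in_sub (hE m mM)).
by apply: subset_trans (edge_in_subset (hE m mM)) _; rewrite subsetDl.
Qed.

Lemma matching_add_edge S M u w : u \in S -> w \in S -> e u w ->
  is_matching e (S :\ u :\ w) M ->
  is_matching e S ([set u; w] |: M) /\ [set u; w] \notin M.
Proof.
move=> uS wS euw hM; have sub := cover_matching hM.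
have /is_matchingP [hE hT] := hM.
have dis m : m \in M -> [disjoint [set u; w] & m].
  move=> mM; rewrite disjoint_sym disjoints_subset.
  apply: subset_trans (edge_in_subset (hE m mM)) _.
  by apply/subsetP => x; rewrite !inE negb_or => /and3P [-> ->].
have nM : [set u; w] \notin M.
  apply/negP => /dis /pred0P /(_ u) /=.
  by rewrite !inE eqxx.
split=> //; apply/is_matchingP; split.
  move=> m /setU1P [->|mM]; first by exists u, w.
  apply: (edge_in_sub (hE m mM)); apply: subset_trans (edge_in_subset (hE m mM)) _.
  by apply/subsetP => x; rewrite !inE => /and3P [].
apply/trivIsetP => m1 m2 /setU1P [->|m1M] /setU1P [->|m2M].
- by rewrite eqxx.
- by move=> _; exact: dis.
- by move=> _; rewrite disjoint_sym; exact: dis.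
- exact: (trivIsetP hT).
Qed.

Lemma matching_del_edge S M u w : is_matching e S M -> [set u; w] \in M ->
  is_matching e (S :\ u :\ w) (M :\ [set u; w]).
Proof.
move=> /is_matchingP [hE hT] uwM; apply/is_matchingP; split; last first.
  by apply/trivIsetP => m1 m2 /setD1P [_ ?] /setD1P [_ ?]; exact: (trivIsetP hT).
move=> m /setD1P [ne mM]; apply: (edge_in_sub (hE m mM)).
have sub := edge_in_subset (hE m mM).
have dis : [disjoint m & [set u; w]] by exact: (trivIsetP hT).
apply/subsetP => x xm; rewrite !inE (subsetP sub) // andbT.
have := disjointFr dis xm; rewrite !inE => /norP [-> ->] //.
Qed.

Lemma matching_neighbour S M u : is_matching e S M -> u \in cover M ->
  exists2 w, e u w && ([set u; w] \in M) &
    forall w', e u w' && ([set u; w'] \in M) -> w' = w.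
Proof.
move=> /is_matchingP [hE hT] /bigcupP [m mM um].
have [w Em euw] := edge_in_other (hE m mM) um.
exists w => [|w' /andP [euw' w'M]]; first by rewrite euw -Em.
have : [set u; w'] = m.
  apply/eqP/negP => /negP ne.
  have /pred0P /(_ u) /= := trivIsetP hT _ _ w'M mM ne.
  by rewrite um !inE eqxx.
move=> E; have : w' \in [set u; w] by rewrite -Em -E set22.
by case/set2P => // ?; subst; rewrite e_irr in euw'.
Qed.

Variable R : comNzRingType.

Definition mterm S M : {poly R} := (-1) ^+ #|M| * 'X^(#|S| - 2 * #|M|).

(** Summing over matchings instead of over sizes lets the recurrence come from bijections; no
    matching is lost, since [card_matching] bounds its size by half of [#|S|]. *)
Lemma mpolyE S : mpoly R e S = \sum_(M | is_matching e S M) mterm S M.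
Proof.
rewrite (partition_big (fun M => inord #|M| : 'I_(#|S|./2).+1) predT) //=.
apply: eq_bigr => r _.
rewrite (eq_bigl (fun M => is_matching e S M && (#|M| == r))); last first.
  move=> M; case hM: is_matching => //=; rewrite -val_eqE /= inordK // ltnS.
  by rewrite geq_half_double -mul2n card_matching.
rewrite (eq_bigr (fun=> (-1) ^+ r * 'X^(#|S| - 2 * r))); last first.
  by move=> M /andP [_ /eqP <-].
rewrite sumr_const /nmatch cardsE.
rewrite -mul_polyC rmorphM rmorphXn rmorphN1 rmorph_nat -mulrA mulr_natl mulrnAr.
by [].
Qed.

(** The matchings that miss [u] are those of [S :\ u]; any other one is an edge [[set u; w]] plus a
    matching of [S :\ u :\ w], and the removed edge accounts for the sign. *)
Lemma mpoly_rec S u : u \in S ->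
  mpoly R e S = 'X * mpoly R e (S :\ u)
    - \sum_(w in S | e u w) mpoly R e (S :\ u :\ w).
Proof.
move=> uS; rewrite mpolyE (bigID (fun M => u \in cover M)) /= addrC; congr (_ + _).
  rewrite mpolyE big_distrr /=; under eq_bigl do rewrite is_matching_avoid.
  apply: eq_bigr => M hM; have := card_matching hM.
  rewrite /mterm (cardsD1 u S) uS add1n => le.
  by rewrite subSn // exprS mulrCA.
rewrite -sumrN.
(* The inner sum runs over the edges of [M] at [u] and has exactly one term; it is inserted so that
   the order of summation can be exchanged. *)
transitivity (\sum_(M | is_matching e S M && (u \in cover M))
   \sum_(w | e u w && ([set u; w] \in M)) mterm S M).
  apply: eq_bigr => M /andP [hM uM]; have [w hw uniq_w] := matching_neighbour hM uM.
  rewrite (big_pred1 w) // => w'; apply/idP/eqP => [/uniq_w //|->]; exact: hw.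
rewrite (exchange_big_dep (fun w => (w \in S) && e u w)) /=; last first.
  move=> M w /andP [/is_matchingP [hE _] _] /andP [euw /hE /edge_in_ends [_ -> _]] //.
apply: eq_bigr => w /andP [wS euw]; rewrite mpolyE -sumrN.
rewrite (reindex_onto (fun M => [set u; w] |: M)
                      (fun M => M :\ [set u; w])) /=; last first.
  by move=> M /andP [_ /andP [_ ?]]; rewrite setD1K.
apply: eq_big => [M|M].
  rewrite euw setU11 !andbT /=; apply/andP/idP => [[/andP [hM _] /eqP E]|hM].
    by have := matching_del_edge hM (setU11 _ _); rewrite E.
  have [hM' nM] := matching_add_edge uS wS euw hM; split.
    by rewrite hM' /=; apply/bigcupP; exists [set u; w]; rewrite ?setU11 ?set21.
  by rewrite setU1K.
move=> /andP[/andP [/andP [hM _] _] /eqP E].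
rewrite /mterm cardsU1 (_ : [set u; w] \notin M) /=; last by rewrite -E !inE eqxx.
rewrite add1n exprS mulN1r mulNr; congr (- (_ * 'X^_)).
rewrite (cardsD1 u S) uS (cardsD1 w (S :\ u)) !inE wS.
rewrite (_ : w != u) /=; last by apply: contraTneq euw => ->; rewrite e_irr.
by rewrite mulnS addnA subnDl.
Qed.

Lemma is_matching0 S : is_matching e S set0.
Proof.
apply/is_matchingP; split=> [m|]; first by rewrite inE.
by apply/trivIsetP => m1 m2; rewrite inE.
Qed.

(** Only the empty matching contributes in degree [#|S|]; hence the polynomial is nonzero over every
    nontrivial ring. *)
Lemma coef_mpoly_card S : (mpoly R e S)`_#|S| = 1.
Proof.
rewrite mpolyE coef_sum (bigD1 set0) ?is_matching0 //= big1 ?addr0.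
  by rewrite /mterm cards0 expr0 mul1r muln0 subn0 coefXn eqxx.
move=> M /andP [hM M0]; have := card_matching hM.
rewrite /mterm -(rmorphN1 polyC) -(rmorphXn polyC) coefCM coefXn => le.
rewrite (_ : _ == _ = false) ?mulr0 //; apply/negbTE.
have : (0 < #|M|)%N by rewrite card_gt0.
move=> M1; rewrite neq_ltn orbC ltn_subrL muln_gt0 M1 /=.
by rewrite (leq_trans _ le) // muln_gt0.
Qed.

Lemma mpoly_neq0 S : mpoly R e S != 0.
Proof.
by apply: contra_neq (oner_neq0 R) => E; rewrite -(coef_mpoly_card S) E coef0.
Qed.

Lemma mpoly_set0 : mpoly R e set0 = 1.
Proof.
rewrite mpolyE (big_pred1 set0) => [|M /=].
  by rewrite /mterm !cards0 expr0 mul1r.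
apply/idP/eqP => [hM|->]; last exact: is_matching0.
by have := card_matching hM; rewrite cards0 leqn0 muln_eq0 /= => /eqP/cards0_eq.
Qed.

End MatchingPolynomial.

(** * Orders of vanishing at 0 and sums of squares of polynomials *)

Section SumsOfSquares.
Variable R : realDomainType.
Implicit Types (p q : {poly R}) (s : seq {poly R}).

(** Divisibility by ['X^k], phrased on coefficients so that it covers the zero polynomial and passes
    directly to sums. *)
Definition vanish k p := forall i, (i < k)%N -> p`_i = 0.

Lemma vanishW k l p : (k <= l)%N -> vanish l p -> vanish k p.
Proof. by move=> le hp i lt; apply: hp; exact: leq_trans le. Qed.

Lemma vanishS k p : vanish k p -> p`_k = 0 -> vanish k.+1 p.
Proof. by move=> hp pk i; rewrite ltnS leq_eqVlt => /predU1P [->|/hp]. Qed.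

Lemma vanishD k p q : vanish k p -> vanish k q -> vanish k (p + q).
Proof. by move=> hp hq i lt; rewrite coefD hp ?hq ?addr0. Qed.

Lemma vanishN k p : vanish k p -> vanish k (- p).
Proof. by move=> hp i lt; rewrite coefN hp ?oppr0. Qed.

Lemma vanish_sum (I : Type) (r : seq I) (Q : pred I) (F : I -> {poly R}) k :
  (forall i, Q i -> vanish k (F i)) -> vanish k (\sum_(i <- r | Q i) F i).
Proof. by move=> hF i lt; rewrite coef_sum big1 // => j /hF ->. Qed.

Lemma vanish_factor k p : vanish k p -> p = drop_poly k p * 'X^k.
Proof.
move=> hp; rewrite -[LHS](poly_take_drop k) [take_poly _ _](_ : _ = 0) ?add0r //.
by apply/polyP => i; rewrite coef_take_poly coef0; case: ifP => // /hp.
Qed.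

Lemma mul_factor j k p q : vanish j p -> vanish k q ->
  p * q = drop_poly j p * drop_poly k q * 'X^(j + k).
Proof.
by move=> /vanish_factor {1}-> /vanish_factor {1}->; rewrite mulrACA -exprD.
Qed.

Lemma vanishM j k p q : vanish j p -> vanish k q -> vanish (j + k) (p * q).
Proof. by move=> hp hq i lt; rewrite (mul_factor hp hq) coefMXn lt. Qed.

Lemma coef_vanishM j k p q : vanish j p -> vanish k q ->
  (p * q)`_(j + k) = p`_j * q`_k.
Proof.
move=> hp hq; rewrite (mul_factor hp hq) coefMXn ltnn subnn coef0M.
by rewrite !coef_drop_poly !add0n.
Qed.

Lemma vanishMl k p q : vanish k q -> vanish k (p * q).
Proof. by move=> hq; rewrite -[k]add0n; apply: vanishM. Qed.

Definition sum_squares s := \sum_(q <- s) q ^+ 2.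

Lemma coef_sum_squares k s : (forall q, q \in s -> vanish k q) ->
  (sum_squares s)`_k.*2 = \sum_(q <- s) q`_k ^+ 2.
Proof.
move=> hs; rewrite coef_sum big_seq [RHS]big_seq; apply: eq_bigr => q /hs hq.
by rewrite expr2 -addnn coef_vanishM.
Qed.

Lemma vanish_sum_squares k s : (forall q, q \in s -> vanish k q) ->
  vanish k.*2 (sum_squares s).
Proof.
move=> hs; rewrite /sum_squares big_seq; apply: vanish_sum => q /hs hq.
by rewrite expr2 -addnn; apply: vanishM.
Qed.

(** In an ordered domain the lowest even coefficient is a sum of squares, so it vanishes only
    termwise. The bound [k.*2.-1] instead of [k.*2] carries the parity argument: a nonzero sum of
    squares cannot have odd order. *)
Lemma sum_squares_vanish k s : vanish k.*2.-1 (sum_squares s) ->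
  forall q, q \in s -> vanish k q.
Proof.
elim: k => [|k IH] hs q qs; first by [].
have {}IH : forall q, q \in s -> vanish k q.
  by apply: IH; apply: vanishW hs; lia.
apply: vanishS; first exact: IH.
have /eqP : (sum_squares s)`_k.*2 = 0 by rewrite hs // doubleS.
rewrite coef_sum_squares // psumr_eq0 => [/allP /(_ q qs)|? _]; last exact: sqr_ge0.
by rewrite sqrf_eq0 => /eqP.
Qed.

End SumsOfSquares.

(** * Weighted vertex recurrences over a commutative ring *)

Section VertexRecurrence.
Variables (T : finType) (e : rel T).
Hypotheses (e_sym : symmetric e) (e_irr : irreflexive e).
Implicit Types (S : {set T}) (u v w : T).

Lemma setD1C S u w : S :\ u :\ w = S :\ w :\ u.
Proof. by rewrite !setDDl setUC. Qed.

Lemma edge_neq u w : e u w -> w != u.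
Proof. by apply: contraTneq => ->; rewrite e_irr. Qed.

(** The weight depends on the vertex so that a single weight can be changed; the constant weights
    ['X] and ['X + theta%:P] give the matching polynomial and its shift. *)
Definition vertex_rec (K : comNzRingType) (z : T -> K) (nu : {set T} -> K) :=
  forall S u, u \in S ->
    nu S = z u * nu (S :\ u) - \sum_(w in S | e u w) nu (S :\ u :\ w).

(* This is the Heilmann-Lieb identity: unfolding the recursion, the squares are
   those of [nu (S :\: V(P))] for the paths [P] from [u] to [w] in [S]. *)
Lemma rayleigh_sum_squares (K : comNzRingType) (z : T -> K) nu S u w :
  vertex_rec z nu -> u \in S -> w \in S -> u != w ->
  exists2 s : seq K,
    nu (S :\ u) * nu (S :\ w) - nu S * nu (S :\ u :\ w) = \sum_(q <- s) q ^+ 2 &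
    e u w -> nu (S :\ u :\ w) \in s.
Proof.
move=> nuE; have [n] := ubnP #|S|; elim: n S u w => // n IH S u w leSn uS wS uw.
(* Expanding [nu S] and [nu (S :\ w)] at [u] leaves the same kind of difference for the pairs [y],
   [w] in the smaller set [S :\ u]; the term [y = w] is the pure square. *)
have E : nu (S :\ u) * nu (S :\ w) - nu S * nu (S :\ u :\ w) =
    (if e u w then nu (S :\ u :\ w) ^+ 2 else 0) +
    \sum_(y in S :\ w | e u y) (nu (S :\ u :\ y) * nu (S :\ u :\ w)
                                - nu (S :\ u) * nu (S :\ u :\ y :\ w)).
  rewrite (nuE S u uS) (nuE (S :\ w) u); last by rewrite !inE uw.
  rewrite sumrB -mulr_sumr -mulr_suml (setD1C S w u).
  have -> : \sum_(y in S :\ w | e u y) nu (S :\ u :\ w :\ y) =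
            \sum_(y in S :\ w | e u y) nu (S :\ u :\ y :\ w).
    by apply: eq_bigr => y _; rewrite setD1C.
  have -> : \sum_(y in S | e u y) nu (S :\ u :\ y) =
      (if e u w then nu (S :\ u :\ w) else 0) +
      \sum_(y in S :\ w | e u y) nu (S :\ u :\ y).
    case: ifP => euw.
      rewrite (bigD1 w) ?wS //=; congr (_ + _); apply: eq_bigl => y.
      by rewrite !inE andbC andbA.
    rewrite add0r; apply: eq_bigl => y; rewrite !inE.
    by case: eqP => // ->; rewrite euw andbF.
  have -> : (if e u w then nu (S :\ u :\ w) ^+ 2 else 0) =
      (if e u w then nu (S :\ u :\ w) else 0) * nu (S :\ u :\ w).
    by case: ifP; rewrite ?mul0r ?expr2.
  set A := \sum_(_ in _ | _) _; set B := \sum_(_ in _ | _) _.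
  set c := if _ then _ else _; set a := nu (S :\ u); set b := nu (S :\ u :\ w).
  by ring.
rewrite {}E.
pose sos (p : K) := exists s, p = \sum_(q <- s) q ^+ 2.
have sos_sum : sos (\sum_(y in S :\ w | e u y) (nu (S :\ u :\ y) * nu (S :\ u :\ w)
                                - nu (S :\ u) * nu (S :\ u :\ y :\ w))).
  apply: big_ind => [|_ _ [s1 ->] [s2 ->]|y /andP [/setD1P [yw yS] euy]].
  - by exists [::]; rewrite big_nil.
  - by exists (s1 ++ s2); rewrite big_cat.
  have [||||s -> _] := IH (S :\ u) y w; last by exists s.
  - by move: leSn; rewrite (cardsD1 u S) uS.
  - by rewrite !inE yS edge_neq.
  - by rewrite !inE eq_sym uw.
  - by [].
case: sos_sum => s ->; case: ifP => euw.
  by exists (nu (S :\ u :\ w) :: s); rewrite ?big_cons ?mem_head.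
by exists s; rewrite ?add0r.
Qed.

(** A solution is affine in the weight of [v] with slope [nu (S :\ v)], which is what a unit
    increase of that weight adds. *)
Lemma vertex_rec_perturb (K : comNzRingType) (z : T -> K) nu v :
  vertex_rec z nu ->
  vertex_rec (fun u => if u == v then z u + 1 else z u)
             (fun S => nu S + (if v \in S then nu (S :\ v) else 0)).
Proof.
move=> nuE S u uS.
have [Euv|uv] := eqVneq u v.
  rewrite -Euv uS setD11 addr0 mulrDl mul1r addrAC (nuE S u uS); congr (_ - _ + _).
  by apply: eq_bigr => w _; rewrite !inE eqxx andbF addr0.
rewrite big_split /= (nuE S u uS) !inE [v == u]eq_sym uv /=.
have [vS|vS] := boolP (v \in S); last first.
  rewrite !addr0 [X in _ - (_ + X)]big1 ?addr0 // => w _.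
  by rewrite !inE (negbTE vS) !andbF.
rewrite (nuE (S :\ v) u) ?inE ?uv // mulrDr opprD addrACA setD1C.
congr (_ + (_ - _)); rewrite big_mkcond [RHS]big_mkcond; apply: eq_bigr => w _.
rewrite !inE [v == u]eq_sym uv vS !andbT [v == w]eq_sym; case: eqP => //= _.
  by case: ifP.
by case: ifP => // _; rewrite setD1C.
Qed.

Lemma vertex_rec_prod (K : comNzRingType) (z : T -> K) nu S1 S2 :
  vertex_rec z nu -> nu set0 = 1 -> [disjoint S1 & S2] ->
  (forall x y, x \in S1 -> y \in S2 -> ~~ e x y) ->
  nu (S1 :|: S2) = nu S1 * nu S2.
Proof.
move=> nuE nu0; have [n] := ubnP #|S1|; elim: n S1 => // n IH S1 leSn dis sep.
have [->|[u uS]] := set_0Vmem S1; first by rewrite set0U nu0 mul1r.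
have uS2 : u \notin S2 by rewrite (disjointFr dis uS).
have subD S' : S' \subset S1 :\ u -> nu (S' :|: S2) = nu S' * nu S2.
  move=> sub; have sub1 : S' \subset S1 := subset_trans sub (subsetDl _ _).
  apply: IH.
  - apply: leq_ltn_trans (subset_leq_card sub) _.
    by move: leSn; rewrite (cardsD1 u S1) uS.
  - exact: disjointWl dis.
  - by move=> x y /(subsetP sub1); exact: sep.
have UD w S' : w \notin S2 -> (S' :|: S2) :\ w = (S' :\ w) :|: S2.
  move=> wS2; rewrite setDUl; congr (_ :|: _); apply/setDidPl.
  by rewrite disjoint_sym disjoints1.
rewrite (nuE _ u) ?inE ?uS // (nuE S1 u uS) UD // subD // mulrBl mulrA; congr (_ - _).
rewrite mulr_suml; apply: eq_big => [w|w /andP [wS euw]].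
  rewrite inE; case: (boolP (w \in S1)) => //= _; apply/negP => /andP [w2 euw].
  by have /negP := sep _ _ uS w2.
have w2 : w \notin S2 by apply: contraL euw; exact: sep.
by rewrite UD // subD // subsetDl.
Qed.

(** By induction: after expansion at [u], the terms that belong to a given [y] other than [u]
    regroup into the recurrence of [nu (S :\ y)] at [u]. *)
Lemma vertex_rec_deriv (R : comNzRingType) (z : T -> {poly R}) nu S :
  vertex_rec z nu -> (forall u, (z u)^`() = 1) -> nu set0 = 1 ->
  (nu S)^`() = \sum_(u in S) nu (S :\ u).
Proof.
move=> nuE dz nu0; have [n] := ubnP #|S|; elim: n S => // n IH S leSn.
have [->|[u uS]] := set_0Vmem S; first by rewrite nu0 big_set0 -polyC1 derivC.
have {}IH S' : S' \subset S :\ u -> (nu S')^`() = \sum_(y in S') nu (S' :\ y).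
  move=> sub; apply: IH; apply: leq_ltn_trans (subset_leq_card sub) _.
  by move: leSn; rewrite (cardsD1 u S) uS.
rewrite (nuE S u uS) derivB derivM dz mul1r IH // raddf_sum (bigD1 u uS) /= -addrA.
congr (_ + _).
rewrite [X in _ - X](eq_bigr (fun w => \sum_(y in S :\ u :\ w) nu (S :\ u :\ w :\ y))); last first.
  by move=> w _; rewrite /= IH // subsetDl.
rewrite (exchange_big_dep (mem (S :\ u))) /=; last first.
  by move=> w y _; rewrite !inE => /and3P [_ -> ->].
rewrite mulr_sumr -sumrB; apply: eq_big => [y|y]; first by rewrite !inE andbC.
rewrite !inE => /andP [yu yS]; rewrite [RHS](nuE (S :\ y) u) ?inE 1?eq_sym ?yu //.
rewrite [in RHS]setD1C; congr (_ - _); apply: eq_big => [w|w _]; last by rewrite setD1C.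
by rewrite !inE yu yS !andbT [y == w]eq_sym andbC andbA.
Qed.
End VertexRecurrence.

(** * Multiplicity of [theta] under deletion of a vertex *)

Section Multiplicity.
Variables (T : finType) (R : rcfType) (e : rel T) (theta : R).
Hypotheses (e_sym : symmetric e) (e_irr : irreflexive e).
Implicit Types (S : {set T}) (u v w : T).

Local Notation m := (mult theta e).
Local Notation ess := (essential theta e).

(** The shift moves [theta] to 0, so that multiplicities are read off the low coefficients. *)
Definition spoly S : {poly R} := mpoly R e S \Po ('X + theta%:P).

Lemma spoly_rec : vertex_rec e (fun=> 'X + theta%:P) spoly.
Proof.
move=> S u uS; rewrite /spoly (mpoly_rec e_sym e_irr R uS).
rewrite comp_polyB comp_polyM comp_polyX; congr (_ - _).
exact: (raddf_sum (comp_poly _)).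
Qed.

Lemma spoly0 : spoly set0 = 1.
Proof. by rewrite /spoly (mpoly_set0 e_irr) comp_polyC. Qed.

Lemma spoly_factor S :
  exists2 q : {poly R}, spoly S = q * 'X^(m S) & q`_0 != 0.
Proof.
have p0 : mpoly R e S != 0 by apply: mpoly_neq0.
have [k [q]] := multiplicity_XsubC (mpoly R e S) theta; rewrite p0 /= => q0 E.
exists (q \Po ('X + theta%:P)); last first.
  by rewrite -horner_coef0 horner_comp !hornerE.
have -> : m S = k.
  have n0 : ('X - theta%:P) ^+ k != 0 by rewrite expf_neq0 // polyXsubC_eq0.
  have nq0 : q != 0 by apply: contraNneq p0 => q00; rewrite E q00 mul0r.
  by rewrite /mult E mupM // mup_XsubCX eqxx mupNroot.
rewrite /spoly {1}E comp_polyM rmorphXn /= comp_polyB comp_polyX comp_polyC addrK.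
by [].
Qed.

Lemma vanish_spoly S : vanish (m S) (spoly S).
Proof. by have [q -> _] := spoly_factor S => i lt; rewrite coefMXn lt. Qed.

Lemma vanish_spolyW S k : (k <= m S)%N -> vanish k (spoly S).
Proof. by move=> le; exact: vanishW le (@vanish_spoly S). Qed.

Lemma lowest_neq0 S : (spoly S)`_(m S) != 0.
Proof. by have [q -> q0] := spoly_factor S; rewrite coefMXn ltnn subnn. Qed.

Lemma leq_mult S k : vanish k (spoly S) -> (k <= m S)%N.
Proof.
move=> hk; rewrite leqNgt; apply/negP => /hk /eqP.
by rewrite (negbTE (lowest_neq0 S)).
Qed.

Lemma spoly_deriv S : (spoly S)^`() = \sum_(u in S) spoly (S :\ u).
Proof.
apply: (vertex_rec_deriv S spoly_rec) => [u|]; last exact: spoly0.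
by rewrite derivD derivX derivC addr0.
Qed.

Definition rayleigh S u w :=
  spoly (S :\ u) * spoly (S :\ w) - spoly S * spoly (S :\ u :\ w).

Lemma rayleighP S u w : u \in S -> w \in S -> u != w ->
  exists2 s, rayleigh S u w = sum_squares s & e u w -> spoly (S :\ u :\ w) \in s.
Proof. exact: (rayleigh_sum_squares e_irr spoly_rec). Qed.

(** Writing each derivative as a sum over deleted vertices turns the Wronskian into the square of
    [spoly (S :\ u)] plus the Rayleigh differences of [u] with the other vertices. *)
Lemma wronskianP S u : u \in S ->
  exists2 s, spoly (S :\ u) * (spoly S)^`() - spoly S * (spoly (S :\ u))^`() =
      sum_squares s & spoly (S :\ u) \in s.
Proof.
move=> uS.
have -> : spoly (S :\ u) * (spoly S)^`() - spoly S * (spoly (S :\ u))^`() =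
    spoly (S :\ u) ^+ 2 + \sum_(w in S :\ u) rayleigh S u w.
  rewrite !spoly_deriv (bigD1 u uS) /= mulrDr -expr2 -addrA; congr (_ + _).
  rewrite sumrB -!mulr_sumr; congr (_ * _ - _).
  by apply: eq_bigl => w; rewrite !inE andbC.
pose sos (p : {poly R}) := exists s, p = sum_squares s.
have [s ->] : sos (\sum_(w in S :\ u) rayleigh S u w).
  apply: big_ind => [|_ _ [s1 ->] [s2 ->]|w /setD1P [wu wS]].
  - by exists [::]; rewrite /sum_squares big_nil.
  - by exists (s1 ++ s2); rewrite /sum_squares big_cat.
  have uw : u != w by rewrite eq_sym.
  by have [s -> _] := rayleighP uS wS uw; exists s.
by exists (spoly (S :\ u) :: s); rewrite ?mem_head // /sum_squares big_cons.
Qed.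

(** For the orders [k < n] of the two polynomials, the Wronskian has coefficient [n - k] times the
    product of the lowest coefficients at [k + n - 1], and vanishes below. If [n > k + 1], the
    square of [spoly (S :\ u)] would vanish too far; if [n = k + 1], this coefficient is a sum of
    squares with a positive term. *)
Lemma wronskian_lowest S u : u \in S -> (m (S :\ u) < m S)%N ->
  (m S = (m (S :\ u)).+1)%N /\
  0 < (spoly (S :\ u))`_(m (S :\ u)) * (spoly S)`_(m S).
Proof.
move=> uS lt; have [s Es us] := wronskianP uS.
set f := spoly (S :\ u) in Es us *; set g := spoly S in Es *.
set k := m (S :\ u) in lt *; set n := m S in lt *.
have hf : vanish k f by apply: vanish_spoly.
have hg : vanish n g by apply: vanish_spoly.
have f0 : f`_k != 0 by apply: lowest_neq0.
(* Multiplying a derivative by ['X] scales the coefficient at [i] by [i]; this keeps orders of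
   vanishing and avoids an index shift. *)
have coefXd (p : {poly R}) i : ('X * p^`())`_i = p`_i *+ i.
  by rewrite coefXM coef_deriv; case: i => [|i] //=; rewrite mulr0n.
have hXd (p : {poly R}) l : vanish l p -> vanish l ('X * p^`()).
  by move=> hp i lti; rewrite coefXd hp // mul0rn.
set W := sum_squares s in Es.
have EW : 'X * W = f * ('X * g^`()) - g * ('X * f^`()) by rewrite -Es; ring.
have vXW : vanish (k + n) ('X * W).
  rewrite EW; apply: vanishD; first by apply: vanishM => //; exact: hXd.
  by rewrite addnC; apply: vanishN; apply: vanishM => //; exact: hXd.
have WE i : W`_i = ('X * W)`_i.+1 by rewrite coefXM.
have vW : vanish (k + n).-1 W by move=> i lti; rewrite WE vXW //; lia.
have Wl : W`_(k + n).-1 = f`_k * g`_n *+ (n - k).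
  rewrite WE prednK; last by lia.
  rewrite EW coefB (coef_vanishM hf (hXd _ _ hg)).
  rewrite [(k + n)%N]addnC (coef_vanishM hg (hXd _ _ hf)) !coefXd mulrnBr; last exact: ltnW.
  by rewrite !mulrnAr [g`_n * _]mulrC.
have nk : (n <= k.+1)%N.
  rewrite leqNgt; apply/negP => ltn.
  have vf : vanish k.+1 f by apply: (sum_squares_vanish _ us); apply: vanishW vW; lia.
  by move/eqP: (vf k (ltnSn k)); rewrite (negbTE f0).
have En : n = k.+1 by lia.
split=> //; have := Wl; rewrite En subSnn mulr1n -En => <-.
have sv : forall q, q \in s -> vanish k q.
  by apply: sum_squares_vanish; apply: vanishW vW; lia.
rewrite [(k + n).-1](_ : _ = k.*2); last by lia.
rewrite coef_sum_squares // (big_rem f us) /= ltr_wpDr //.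
  by apply: sumr_ge0 => q _; exact: sqr_ge0.
by rewrite exprn_even_gt0.
Qed.

Lemma mult_del_ge S u : u \in S -> (m S <= (m (S :\ u)).+1)%N.
Proof.
move=> uS; rewrite leqNgt; apply/negP => lt.
by have [] := wronskian_lowest uS; lia.
Qed.

Lemma mult_del_le S u : u \in S -> (m (S :\ u) <= (m S).+1)%N.
Proof.
move=> uS; case E: (m (S :\ u)) => [|k] //; rewrite ltnS; apply: leq_mult.
rewrite (spoly_rec uS); apply: vanishD.
  by apply: vanishMl; apply: vanish_spolyW; rewrite E.
apply: vanishN; apply: vanish_sum => w /andP [wS euw]; apply: vanish_spolyW.
by rewrite -ltnS -E mult_del_ge // !inE wS (edge_neq e_irr).
Qed.

Lemma essentialE S u : ess S u = (u \in S) && ((m (S :\ u)).+1 == m S).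
Proof. by []. Qed.

Lemma essential_lowest S u : ess S u ->
  0 < (spoly (S :\ u))`_(m S).-1 * (spoly S)`_(m S).
Proof.
case/andP=> uS /eqP E; have [|_] := wronskian_lowest uS; first by rewrite -E.
by rewrite -E.
Qed.

(** Without essential vertices the derivative, being the sum of the [spoly (S :\ u)], would vanish
    to order [m S]; in characteristic zero differentiation lowers a positive order. *)
Lemma exists_essential S : (0 < m S)%N -> exists u, ess S u.
Proof.
move=> m0; apply/existsP; apply: contraT => /existsPn none.
have : vanish (m S) (spoly S)^`().
  rewrite spoly_deriv; apply: vanish_sum => u uS; apply: vanish_spolyW.
  have := none u; rewrite essentialE uS /= => ne.
  by have := mult_del_ge uS; lia.
move/(_ (m S).-1); rewrite coef_deriv prednK // => /(_ (leqnn _)) /eqP.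
by rewrite mulrn_eq0 (negbTE (lowest_neq0 S)) orbF; lia.
Qed.

(* If [u] has a neighbour essential in [S :\ u], the lowest-order terms in the
   recurrence at [u] all have the same sign, so they cannot cancel. *)
Lemma mult_del_succP S u : u \in S ->
  (m (S :\ u) = (m S).+1 <-> exists2 w, e u w & ess (S :\ u) w).
Proof.
move=> uS; split=> [E|[w euw wE]].
  apply/exists_inP; apply: contraT => /exists_inPn none.
  have : ((m S).+1 <= m S)%N; last by rewrite ltnn.
  apply: leq_mult; rewrite (spoly_rec uS); apply: vanishD.
    by apply: vanishMl; rewrite -E; exact: vanish_spoly.
  apply: vanishN; apply: vanish_sum => w /andP [wS euw]; apply: vanish_spolyW.
  have wSu : w \in S :\ u by rewrite !inE wS (edge_neq e_irr).
  have := none w euw; rewrite essentialE wSu /= => ne.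
  by have := mult_del_ge wSu; lia.
apply/eqP; rewrite eqn_leq mult_del_le //= leqNgt; apply/negP => lt.
have /andP [_ /eqP Ew] := wE.
set k := m (S :\ u) in lt Ew *.
have k0 : (0 < k)%N by lia.
set c := (spoly (S :\ u))`_k.
(* The factor [c] normalises the common sign: every summand becomes nonnegative and the one at [w]
   positive, so the sum cannot be zero. *)
have sum0 : \sum_(y in S | e u y) (spoly (S :\ u :\ y))`_k.-1 * c = 0.
  have : (spoly S)`_k.-1 = 0 by apply: vanish_spoly; rewrite prednK.
  rewrite (spoly_rec uS) coefB coef_sum.
  have -> : (('X + theta%:P) * spoly (S :\ u))`_k.-1 = 0.
    by apply: (vanishMl _ (@vanish_spoly (S :\ u))); rewrite prednK.
  by rewrite sub0r -mulr_suml => /eqP; rewrite oppr_eq0 => /eqP ->; rewrite mul0r.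
have ge0 y : (y \in S) && e u y -> 0 <= (spoly (S :\ u :\ y))`_k.-1 * c.
  move=> /andP [yS euy]; have ySu : y \in S :\ u by rewrite !inE yS (edge_neq e_irr).
  have [/essential_lowest /ltW //|ne] := boolP (ess (S :\ u) y).
  rewrite (@vanish_spolyW _ k) ?mul0r ?prednK //.
  by move: ne; rewrite essentialE ySu /=; have := mult_del_ge ySu; lia.
have wS : (w \in S) && e u w by case/andP: wE => /setD1P [_ ->].
have := essential_lowest wE; rewrite -/k -/c => /lt0r_neq0/negP; apply.
by have /eqP := sum0; rewrite psumr_eq0 // => /allP /(_ w (mem_index_enum _)); rewrite wS.
Qed.

(** * Special vertices and independent pairs *)

Local Notation spec := (special theta e).

Lemma mult_del2_ge S u w : u \in S -> w \in S -> u != w ->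
  (m S <= (m (S :\ u :\ w)).+2)%N.
Proof.
move=> uS wS uw; apply: leq_trans (mult_del_ge uS) _; rewrite ltnS.
by apply: mult_del_ge; rewrite !inE eq_sym uw.
Qed.

(** Packages the parity gain from order [k.*2.-1] to [k.*2] with the bound coming from the square
    that an edge contributes. *)
Lemma rayleigh_vanish S u w k : u \in S -> w \in S -> u != w ->
  vanish k.*2.-1 (rayleigh S u w) ->
  vanish k.*2 (rayleigh S u w) /\ (e u w -> (k <= m (S :\ u :\ w))%N).
Proof.
move=> uS wS uw; have [s -> sP] := rayleighP uS wS uw => /sum_squares_vanish hs.
by split=> [|/sP /hs /leq_mult //]; apply: vanish_sum_squares.
Qed.

(** Otherwise [m (S :\ a) = m S]. The Rayleigh difference of [a] and an essential neighbour [w] then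
    vanishes to order [2 * m S - 1], hence to [2 * m S], and the edge gives
    [m S <= m (S :\ a :\ w)]. So [spoly (S :\ a) * spoly (S :\ w)], of exact order [2 * m S - 1],
    would vanish to order [2 * m S]. *)
Lemma special_mult S a : spec S a -> m (S :\ a) = (m S).+1.
Proof.
case/and3P=> aS aN /exists_inP [w wS /andP [eaw /andP [_ /eqP Ew]]].
have aw : a != w by rewrite eq_sym (edge_neq e_irr).
have := mult_del_le aS; have := mult_del_ge aS.
move: aN; rewrite essentialE aS /= => aN ge le.
have {ge aN} ge : (m S <= m (S :\ a))%N by lia.
apply/eqP; apply: contraT => ne; have Ea : m (S :\ a) = m S by lia.
have le_aw : (m (S :\ a :\ w) <= m S)%N.
  by rewrite setD1C -Ew mult_del_le // !inE aw.
have ge_aw : ((m S).-1 <= m (S :\ a :\ w))%N.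
  have := @mult_del_ge (S :\ a) w.
  by rewrite !inE eq_sym aw wS => /(_ isT); lia.
have v1 : vanish (m S).*2.-1 (spoly (S :\ a) * spoly (S :\ w)).
  rewrite (_ : _.-1 = m S + (m S).-1)%N; last by lia.
  by apply: vanishM; apply: vanish_spolyW; lia.
have v2 : vanish (m S).*2.-1 (spoly S * spoly (S :\ a :\ w)).
  rewrite (_ : _.-1 = m S + (m S).-1)%N; last by lia.
  by apply: vanishM; apply: vanish_spolyW; lia.
have [vD /(_ eaw) le2] := rayleigh_vanish aS wS aw (vanishD v1 (vanishN v2)).
have v2' : vanish (m S).*2 (spoly S * spoly (S :\ a :\ w)).
  by rewrite -addnn; apply: vanishM; apply: vanish_spolyW.
have : vanish (m S).*2 (spoly (S :\ a) * spoly (S :\ w)).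
  by have := vanishD vD v2'; rewrite /rayleigh subrK.
move/(_ (m (S :\ a) + m (S :\ w))%N); rewrite coef_vanishM; try exact: vanish_spoly.
by move=> H; have /eqP := H ltac:(lia); rewrite mulf_eq0 !(negbTE (lowest_neq0 _)).
Qed.

(** Independence of a pair in the matroid; the additive form avoids truncated subtraction. *)
Definition indep S u w := (m (S :\ u :\ w)).+2 == m S.

Lemma indepC S u w : indep S u w = indep S w u.
Proof. by rewrite /indep setD1C. Qed.

Lemma indepNC S u w : u \in S -> w \in S -> u != w ->
  ~~ indep S u w = (m S <= (m (S :\ u :\ w)).+1)%N.
Proof. by move=> uS wS uw; have := mult_del2_ge uS wS uw; rewrite /indep; lia. Qed.

Lemma indep_neq S u w : u \in S -> indep S u w -> u != w.
Proof.
move=> uS; apply: contraTneq => <-; rewrite /indep.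
by rewrite (_ : S :\ u :\ u = S :\ u) ?setDDl ?setUid //; have := mult_del_ge uS; lia.
Qed.

Lemma indep_essential S u w : u \in S -> w \in S -> u != w -> indep S u w -> ess S u.
Proof.
move=> uS wS uw /eqP E; rewrite essentialE uS.
have := @mult_del_ge S u uS; have := @mult_del_ge (S :\ u) w.
by rewrite !inE eq_sym uw wS => /(_ isT); lia.
Qed.

(** The edge makes [spoly (S :\ u :\ w)] the root of one of the squares, and the Rayleigh difference
    vanishes far enough to force its order up to [(m S).-1]. *)
Lemma adjacent_essential_dep S u w : ess S u -> ess S w -> e u w -> ~~ indep S u w.
Proof.
move=> /andP [uS /eqP Eu] /andP [wS /eqP Ew] euw.
have uw : u != w by rewrite eq_sym (edge_neq e_irr).
rewrite indepNC //.
have [|_ /(_ euw)] := @rayleigh_vanish S u w (m S).-1 uS wS uw; last by lia.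
have := mult_del2_ge uS wS uw => ge2.
apply: vanishD; last apply: vanishN.
  apply: (@vanishW _ _ ((m S).-1 + (m S).-1)%N); first by lia.
  by apply: vanishM; apply: vanish_spolyW; lia.
apply: (@vanishW _ _ (m S + (m S).-2)%N); first by lia.
by apply: vanishM; apply: vanish_spolyW; lia.
Qed.

(** Isolates [b * c], the product of odd order in the next proof. *)
Lemma expand_product_sub (K : comNzRingType) (a b c d x : K) :
  x - (a + b) * (c + d) = x - a * (c + d) - b * d - b * c.
Proof. by ring. Qed.

(* Dependence is transitive.  If it failed, adding 1 to the weight of [v] would
   turn the sum of squares [rayleigh S u w] into one of odd order at [theta]. *)
Lemma indep_exchange S u w v : u \in S -> w \in S -> ess S v ->
  indep S u w -> indep S u v || indep S v w.
Proof.
move=> uS wS vE iuw; have uw := indep_neq uS iuw.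
have [<-|uv] := eqVneq u v; first by rewrite iuw orbT.
have [<-|wv] := eqVneq w v; first by rewrite iuw.
have /andP [vS /eqP Ev] := vE.
apply: contraT; rewrite negb_or indepC [indep S v w]indepC => /andP [nuv nwv].
have uE := indep_essential uS wS uw iuw.
have wE : ess S w by apply: (indep_essential wS uS); rewrite 1?eq_sym // indepC.
move/andP: uE => [_ /eqP Eu]; move/andP: wE => [_ /eqP Ew].
move: nuv nwv; rewrite indepC !indepNC // => nuv nwv.
move/eqP: iuw; set k := m (S :\ u :\ w) => Ek.
have nuwv : (k <= m (S :\ u :\ w :\ v))%N.
  rewrite -ltnS (leq_trans _ (_ : m (S :\ u :\ v) <= _)%N) //; first by lia.
  by rewrite [S :\ u :\ w :\ v]setD1C; apply: mult_del_ge; rewrite !inE wv wS eq_sym uw.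
have hPu : vanish k.+1 (spoly (S :\ u)) by apply: vanish_spolyW; lia.
have hPw : vanish k.+1 (spoly (S :\ w)) by apply: vanish_spolyW; lia.
have hPv : vanish k.+1 (spoly (S :\ v)) by apply: vanish_spolyW; lia.
have hPuv : vanish k.+1 (spoly (S :\ u :\ v)) by apply: vanish_spolyW; lia.
have hPwv : vanish k.+1 (spoly (S :\ w :\ v)) by apply: vanish_spolyW; lia.
have hP : vanish k.+2 (spoly S) by apply: vanish_spolyW; lia.
have hPuw : vanish k (spoly (S :\ u :\ w)) by apply: vanish_spolyW; lia.
have hPuwv : vanish k (spoly (S :\ u :\ w :\ v)) by apply: vanish_spolyW; lia.
have kE : (k.+1).*2 = (k.+1 + k.+1)%N by lia.
have kE2 : (k.+1).*2 = (k.+2 + k)%N by lia.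
have kE1 : (k.+1).*2.-1 = (k.+1 + k)%N by lia.
have lv : (spoly (S :\ v))`_k.+1 != 0.
  by rewrite (_ : k.+1 = m (S :\ v)) ?lowest_neq0 //; lia.
have h1 : vanish k.+1.*2 (spoly (S :\ u :\ v) * spoly (S :\ w :\ v)).
  by rewrite kE; apply: vanishM.
(* The Rayleigh difference of [u] and [w] in [S :\ v] vanishes to order [2k + 1], hence to [2k + 2];
   its first product already does, so the second does too. *)
have h2 : vanish k.+1.*2 (spoly (S :\ v) * spoly (S :\ u :\ w :\ v)).
  have E : rayleigh (S :\ v) u w = spoly (S :\ u :\ v) * spoly (S :\ w :\ v)
      - spoly (S :\ v) * spoly (S :\ u :\ w :\ v).
    by rewrite /rayleigh (setD1C S v u) (setD1C S v w) (setD1C (S :\ u) v w).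
  have [|||h _] := @rayleigh_vanish (S :\ v) u w k.+1 _ _ uw; rewrite ?inE ?uv ?wv //.
    rewrite E kE1; apply: vanishD; first by apply: vanishW h1; lia.
    by apply: vanishN; apply: vanishM.
  by have := vanishD h1 (vanishN h); rewrite E opprB addrC subrK.
have [s] := rayleigh_sum_squares e_irr (vertex_rec_perturb v spoly_rec) uS wS uw.
rewrite !inE vS ![v == _]eq_sym uv wv /= => Es _.
rewrite expand_product_sub in Es; set A := (X in X - _ - _ - _ = _) in Es.
have hA : vanish k.+1.*2 A by rewrite kE; apply: vanishM; apply: vanishD.
have hB : vanish k.+1.*2 (spoly S * (spoly (S :\ u :\ w) + spoly (S :\ u :\ w :\ v))).
  by rewrite kE2; apply: vanishM => //; apply: vanishD.
have hC : vanish k.+1.*2.-1 (spoly (S :\ v) * spoly (S :\ u :\ w)).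
  by rewrite kE1; apply: vanishM.
have hABC := vanishD (vanishD hA (vanishN hB)) (vanishN h2).
(* Parity again: the perturbed sum of squares vanishes to order [2k + 2], which forces the same on
   the isolated product of exact order [2k + 1]. *)
have hs : vanish k.+1.*2 (sum_squares s).
  apply/vanish_sum_squares/sum_squares_vanish; rewrite /sum_squares -Es.
  by apply: vanishD; [apply: vanishW hABC; exact: leq_pred|exact: vanishN].
have /(_ (k.+1 + k)%N) : vanish k.+1.*2 (spoly (S :\ v) * spoly (S :\ u :\ w)).
  by have := vanishD hABC (vanishN hs); rewrite /sum_squares -Es subKr.
rewrite coef_vanishM // => H; have /eqP := H ltac:(lia).
by rewrite mulf_eq0 (negbTE lv) (negbTE (lowest_neq0 _)).
Qed.

(** A stability property in the style of Gallai. For the harder direction, a vertex [v] essential in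
    [S :\ a] is independent there of some neighbour [x] of [a]; then [x] is essential in
    [S :\ v :\ a], so deleting [a] raises the multiplicity of [S :\ v] as it does that of [S]. *)
Lemma essential_del_special S a v : spec S a -> v != a ->
  ess (S :\ a) v = ess S v.
Proof.
move=> aSp va; have Ea := special_mult aSp.
have /and3P [aS _ /exists_inP [w wS /andP [eaw wE]]] := aSp.
have ess_del x : x != a -> ess S x -> ess (S :\ a) x.
  move=> xa /andP [xS /eqP Ex]; rewrite essentialE !inE xa xS Ea eqSS /=.
  have := @mult_del_ge (S :\ a) x; rewrite !inE xa xS => /(_ isT).
  have := @mult_del_le (S :\ x) a; rewrite !inE eq_sym xa aS => /(_ isT).
  by rewrite setD1C; lia.
apply/idP/idP; last exact: ess_del.
move=> vE; have /andP [/setD1P [_ vS] /eqP Ev] := vE.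
have wa : w != a := edge_neq e_irr eaw.
have wE' := ess_del w wa wE.
have /andP [_ /eqP Ew] := wE; have /andP [waS] := wE'; rewrite setD1C => /eqP Ew'.
have aSw : a \in S :\ w by rewrite !inE eq_sym wa.
(* Deleting [a] also raises the multiplicity of [S :\ w]. This yields a second neighbour [y] of [a],
   independent of [w] in [S :\ a], and exchange makes [v] independent of [w] or [y]. *)
have [|y eay yE] := (mult_del_succP aSw).1; first by apply: succn_inj; rewrite Ew' Ea Ew.
have /andP [yS /eqP Ey] := yE.
have wy : indep (S :\ a) w y.
  by rewrite /indep (setD1C S a w) Ey Ew'.
have ya : y \in S :\ a by move: yS; rewrite !inE => /and3P [-> _ ->].
have [x [eax xS ix]] : exists x, [/\ e a x, x \in S :\ a & indep (S :\ a) v x].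
  case/orP: (indep_exchange waS ya vE wy) => i; last by exists y.
  by exists w; rewrite indepC.
have vaS : v \in S :\ a by rewrite !inE va.
have vx := indep_neq vaS ix.
have aSv : a \in S :\ v by rewrite !inE eq_sym va.
move/eqP: ix; rewrite -Ev (setD1C S a v) => /succn_inj ix.
have xE : ess (S :\ v :\ a) x.
  rewrite essentialE ix eqxx andbT; move: xS; rewrite !inE => /andP [-> ->].
  by rewrite eq_sym vx.
rewrite essentialE vS -((mult_del_succP aSv).2 (ex_intro2 _ _ x eax xE)) /=.
by rewrite -eqSS (setD1C S v a) Ev Ea.
Qed.

Lemma special_del_special S a v : spec S a -> v != a ->
  spec (S :\ a) v = spec S v.
Proof.
move=> aSp va; have /and3P [aS aN _] := aSp.
rewrite /special !inE va essential_del_special //=; congr [&& _, _ & _].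
apply/exists_inP/exists_inP => -[w wS /andP [evw wE]].
  have /setD1P [wa wS'] := wS; exists w; rewrite // evw -(@essential_del_special _ a) //.
have wa : w != a by apply: contraNneq aN => <-.
by exists w; rewrite ?inE ?wa // evw essential_del_special.
Qed.

(** The vertices are deleted one at a time; stability keeps the remaining ones special. *)
Lemma del_all_special S (B : {set T}) : (forall a, a \in B -> spec S a) ->
  [/\ m (S :\: B) = (m S + #|B|)%N,
      forall v, v \notin B -> ess (S :\: B) v = ess S v &
      forall v, v \notin B -> spec (S :\: B) v = spec S v].
Proof.
have [n] := ubnP #|B|; elim: n S B => // n IH S B leBn hB.
have [->|[a aB]] := set_0Vmem B; first by rewrite setD0 cards0 addn0.
have aSp := hB a aB; move: leBn; rewrite (cardsD1 a B) aB ltnS => leBn.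
have [|E1 E2 E3] := IH (S :\ a) (B :\ a) leBn.
  by move=> b /setD1P [ba bB]; rewrite special_del_special ?hB.
have DE : S :\ a :\: (B :\ a) = S :\: B by rewrite setDDl setD1K.
rewrite DE in E1 E2 E3; split.
- by rewrite E1 special_mult // addSnnS.
- move=> v vB; rewrite E2 ?inE ?negb_and ?vB ?orbT //.
  by rewrite essential_del_special //; apply: contraNneq vB => ->.
- move=> v vB; rewrite E3 ?inE ?negb_and ?vB ?orbT //.
  by rewrite special_del_special //; apply: contraNneq vB => ->.
Qed.

(** * Disjoint unions and addition of universal vertices *)

Lemma mult_separated S1 S2 : [disjoint S1 & S2] ->
  (forall x y, x \in S1 -> y \in S2 -> ~~ e x y) ->
  m (S1 :|: S2) = (m S1 + m S2)%N.
Proof.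
move=> dis sep; rewrite /mult.
have E : mpoly R e (S1 :|: S2) = mpoly R e S1 * mpoly R e S2.
  have rec : vertex_rec e (fun=> 'X) (mpoly R e) by move=> S u; exact: mpoly_rec.
  exact: (vertex_rec_prod rec (mpoly_set0 e_irr R) dis sep).
by rewrite E mupM // mpoly_neq0.
Qed.

(** The bound [#|B| <= m X] keeps the multiplicity positive before each addition. An essential
    vertex therefore exists, and as a neighbour of the new universal vertex it forces a drop by
    one. *)
Lemma mult_add_universal (X B : {set T}) : [disjoint B & X] ->
  (forall a y, a \in B -> y != a -> e a y) -> (#|B| <= m X)%N ->
  (m (X :|: B) + #|B|)%N = m X.
Proof.
have [n] := ubnP #|B|; elim: n B => // n IH B leBn dis univ.
have [->|[a aB]] := set_0Vmem B; first by rewrite setU0 cards0 addn0.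
have aX : a \notin X by rewrite (disjointFr dis aB).
move: leBn; rewrite (cardsD1 a B) aB ltnS => leBn leX.
have {}IH : (m (X :|: B :\ a) + #|B :\ a|)%N = m X.
  apply: IH => // [|b y /setD1P [_ bB]|]; first exact: disjointWl (subsetDl _ _) dis.
    exact: univ.
  exact: ltnW.
have DE : (X :|: B) :\ a = X :|: B :\ a.
  rewrite setDUl; congr (_ :|: _); apply/setDidPl.
  by rewrite disjoint_sym disjoints1.
have aXB : a \in X :|: B by rewrite inE aB orbT.
have [|y yE] := @exists_essential (X :|: B :\ a).
  by rewrite -(ltn_add2r #|B :\ a|) IH add0n.
have ya : y != a.
  by case/andP: yE => + _; apply: contraTneq => ->; rewrite -DE !inE eqxx.
rewrite -DE in yE IH.
have := (mult_del_succP aXB).2 (ex_intro2 _ _ y (univ a y aB ya) yE).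
by rewrite -IH => ->; rewrite addSnnS.
Qed.

Lemma mult_add_ge (X B : {set T}) : [disjoint B & X] -> (m X <= m (X :|: B) + #|B|)%N.
Proof.
have [n] := ubnP #|B|; elim: n B => // n IH B leBn dis.
have [->|[a aB]] := set_0Vmem B; first by rewrite setU0 cards0 addn0.
have aX : a \notin X by rewrite (disjointFr dis aB).
move: leBn; rewrite (cardsD1 a B) aB ltnS => leBn.
have DE : (X :|: B) :\ a = X :|: B :\ a.
  rewrite setDUl; congr (_ :|: _); apply/setDidPl.
  by rewrite disjoint_sym disjoints1.
have aXB : a \in X :|: B by rewrite inE aB orbT.
apply: leq_trans (IH _ leBn _) _; first exact: disjointWl (subsetDl _ _) dis.
by rewrite -DE addnA leq_add2r addn1 mult_del_le.
Qed.

End Multiplicity.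

(** * Components and critical components *)

Section Components.
Variables (T : finType) (R : rcfType) (e : rel T) (theta : R).
Hypotheses (e_sym : symmetric e) (e_irr : irreflexive e).
Implicit Types (S C K : {set T}) (u v w x y : T).

Local Notation m := (mult theta e).
Local Notation ess := (essential theta e).
Local Notation spec := (special theta e).

Lemma connect_induced_sym S : connect_sym (induced e S).
Proof.
by apply: sym_connect_sym => x y; rewrite /induced /= e_sym andbCA.
Qed.

Lemma comp_eq S u x : x \in Defs.comp e S u -> Defs.comp e S x = Defs.comp e S u.
Proof.
rewrite inE => /andP [_ ux]; apply/setP => y; rewrite !inE.
by rewrite (same_connect (@connect_induced_sym S) ux).
Qed.

Lemma comp_closed S u x y : x \in Defs.comp e S u -> y \in S -> e x y ->
  y \in Defs.comp e S u.
Proof.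
rewrite !inE => /andP [xS ux] yS exy; rewrite yS (connect_trans ux) //.
by apply: connect1; rewrite /induced /= xS yS.
Qed.

Lemma connect_induced_ind S (Q : T -> Prop) :
  (forall x y, x \in S -> y \in S -> e x y -> Q x -> Q y) ->
  forall x y, Q x -> connect (induced e S) x y -> Q y.
Proof.
move=> step x _ Qx /connectP [p + ->]; elim: p x Qx => //= y p IH x Qx.
by case/andP=> /and3P [xS yS exy]; apply: IH; exact: step Qx.
Qed.

Lemma comp_connected S u x y : x \in Defs.comp e S u -> y \in Defs.comp e S u ->
  connect (induced e (Defs.comp e S u)) x y.
Proof.
move=> xC; have := comp_eq xC; set C := Defs.comp e S u in xC * => Ex.
move=> yC; have : connect (induced e S) x y by move: yC; rewrite -Ex inE => /andP [].
suff : connect (induced e S) x y -> y \in C /\ connect (induced e C) x y.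
  by move=> H /H [].
apply: (@connect_induced_ind S (fun y => y \in C /\ connect (induced e C) x y)) => //.
move=> y1 y2 _ y2S ey [y1C xy1]; have y2C := comp_closed y1C y2S ey.
by split=> //; apply: connect_trans xy1 _; apply: connect1; rewrite /induced /= y1C y2C.
Qed.

Lemma mult_comp S u C K : C \subset Defs.comp e S u -> K \subset S :\: Defs.comp e S u ->
  m (C :|: K) = (m C + m K)%N.
Proof.
move=> /subsetP sC /subsetP sK; apply: mult_separated => // [|x y /sC xC /sK].
  rewrite disjoints_subset; apply/subsetP => x /sC xC; rewrite inE.
  by apply/negP => /sK; rewrite inE xC.
by rewrite inE => /andP [yC yS]; apply: contra yC; exact: comp_closed.
Qed.

Lemma comp_split S u : S = Defs.comp e S u :|: (S :\: Defs.comp e S u).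
Proof.
apply/setP => x; rewrite in_setU in_setD; case: (boolP (x \in Defs.comp e S u)) => //=.
by rewrite inE => /andP [].
Qed.

Lemma setD1_comp S u x : x \in Defs.comp e S u ->
  S :\ x = (Defs.comp e S u :\ x) :|: (S :\: Defs.comp e S u).
Proof.
move=> xC; rewrite {1}(comp_split S u) setDUl; congr (_ :|: _); apply/setDidPl.
by rewrite disjoint_sym disjoints1 inE xC.
Qed.

Lemma setD1_compC S u x : x \notin Defs.comp e S u ->
  S :\ x = Defs.comp e S u :|: ((S :\: Defs.comp e S u) :\ x).
Proof.
move=> xC; rewrite {1}(comp_split S u) setDUl; congr (_ :|: _); apply/setDidPl.
by rewrite disjoint_sym disjoints1.
Qed.

Lemma mult_comp_split S u :
  m S = (m (Defs.comp e S u) + m (S :\: Defs.comp e S u))%N.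
Proof. by rewrite {1}(comp_split S u) (@mult_comp S u). Qed.

Lemma essential_comp S u x : x \in Defs.comp e S u -> ess (Defs.comp e S u) x = ess S x.
Proof.
move=> xC; have xS : x \in S by move: xC; rewrite inE => /andP [].
rewrite !essentialE xC xS (setD1_comp xC) (mult_comp_split S u).
by rewrite (@mult_comp S u) ?subsetDl // -addSn eqn_add2r.
Qed.

Lemma essential_compC S u x : x \in S -> x \notin Defs.comp e S u ->
  ess (S :\: Defs.comp e S u) x = ess S x.
Proof.
move=> xS xC; rewrite !essentialE in_setD xC xS (setD1_compC xC) (mult_comp_split S u).
by rewrite (@mult_comp S u) ?subsetDl // -addnS eqn_add2l.
Qed.

Lemma indep_critical S u v :
  (forall x, ~~ spec S x) -> u \in S -> v \in S -> u != v ->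
  (indep e theta S u v <->
   exists H1 H2 : {set T},
    [/\ is_component e S H1 && critical theta e H1,
        is_component e S H2 && critical theta e H2,
        H1 != H2, u \in H1 & v \in H2]).
Proof.
move=> nospec uS vS uv.
(* Without special vertices essentiality spreads along edges, so one essential vertex makes its
   whole component critical. *)
have ess_adj x y : x \in S -> y \in S -> e x y -> ess S x -> ess S y.
  move=> xS yS exy xE; have := nospec y; rewrite /special yS /=.
  by apply: contraR => ->; apply/exists_inP; exists x; rewrite // e_sym exy.
have crit x : ess S x ->
    is_component e S (Defs.comp e S x) && critical theta e (Defs.comp e S x).
  move=> xE; have /andP [xS _] := xE.
  have xC : x \in Defs.comp e S x by rewrite inE xS connect0.
  apply/andP; split; first by apply/exists_inP; exists x.
  apply/and3P; split.
  - by apply/set0Pn; exists x.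
  - by apply/forall_inP => y yC; apply/forall_inP => z; exact: comp_connected.
  apply/forall_inP => y yC; rewrite essential_comp //.
  move: yC; rewrite inE => /andP [_].
  exact: (connect_induced_ind ess_adj).
split=> [iuv|[H1 [H2 [/andP [/exists_inP [x1 x1S /eqP ->] /and3P [_ _ c1]]
                      /andP [/exists_inP [x2 x2S /eqP ->] /and3P [_ _ c2]] ne uH vH]]]].
  have uE := indep_essential e_sym e_irr uS vS uv iuv.
  have vE : ess S v.
    by apply: (indep_essential e_sym e_irr vS uS); rewrite 1?eq_sym // indepC.
  exists (Defs.comp e S u), (Defs.comp e S v).
  split; rewrite ?crit ?inE ?uS ?vS ?connect0 //.
  apply: contraTneq iuv => Euv.
  have : v \in Defs.comp e S u by rewrite Euv inE vS connect0.
  rewrite inE => /andP [_ cuv].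
  suff : ess S v /\ ~~ indep e theta S u v by case.
  (* Along a walk from [u] every vertex stays dependent on [u]: otherwise exchange would make two
     adjacent essential vertices independent. The walk starts from the dependence of [u] on
     itself. *)
  apply: (@connect_induced_ind S (fun y => ess S y /\ ~~ indep e theta S u y) _ u v) cuv.
    move=> x y xS yS exy [xE ux]; have yE := ess_adj x y xS yS exy xE.
    split=> //; apply: contra ux => uy.
    have := indep_exchange e_sym e_irr uS yS xE uy; case/orP=> // xy.
    by have := adjacent_essential_dep e_sym e_irr xE yE exy; rewrite xy.
  by split=> //; apply/negP => /(indep_neq e_sym e_irr uS); rewrite eqxx.
(* Multiplicities add over components, so the two deletions lower different summands by one each. *)
have uE : ess S u by rewrite -(essential_comp uH); exact: (forall_inP c1).
have vE : ess S v by rewrite -(essential_comp vH); exact: (forall_inP c2).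
have uC : u \in Defs.comp e S u by rewrite inE uS connect0.
have vC : v \notin Defs.comp e S u.
  by apply: contraNN ne => vC; rewrite -(comp_eq uH) -(comp_eq vH) (comp_eq vC).
rewrite -(essential_comp uC) in uE; rewrite -(essential_compC vS vC) in vE.
move/andP: uE => [_ /eqP Eu]; move/andP: vE => [_ /eqP Ev].
rewrite /indep (setD1_comp uC) setDUl.
have -> : Defs.comp e S u :\ u :\ v = Defs.comp e S u :\ u.
  by apply/setDidPl; rewrite disjoint_sym disjoints1 in_setD1 (negbTE vC) andbF.
rewrite (mult_comp_split S u) (@mult_comp S u) ?subsetDl //.
by rewrite -Eu -Ev addnS.
Qed.

End Components.

(** * Passage from [e] to [Srel theta e], and the theorem *)

Lemma mpoly_ext (T : finType) (R : nzRingType) (e e' : rel T) (S : {set T}) :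
  {in S &, e =2 e'} -> mpoly R e S = mpoly R e' S.
Proof.
move=> eq_e; rewrite /mpoly; apply: eq_bigr => r _; congr (_ * _%:R *: _).
apply: eq_card => M; rewrite !inE; congr (_ && _); rewrite /is_matching.
congr (_ && _); apply: eq_forallb => a; congr (_ ==> _).
apply: eq_existsb => x; apply: eq_existsb => y.
by case: (boolP (x \in S)) => //= xS; case: (boolP (y \in S)) => //= yS; rewrite eq_e.
Qed.

Theorem theorem5p4 (T : finType) (R : rcfType) (e : rel T) (theta : R)
    (e_sym : symmetric e) (e_irr : irreflexive e)
    (hmult : (2 <= mult theta e [set: T])%N)
    (u v : T) (huv : u != v) :
  (mult theta (Srel theta e) ([set: T] :\: [set u; v])).+2
      = mult theta (Srel theta e) [set: T]
  <->
  exists H1 H2 : {set T},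
    [/\ is_component e (~: Aset theta e) H1 && critical theta e H1,
        is_component e (~: Aset theta e) H2 && critical theta e H2,
        H1 != H2, u \in H1 & v \in H2].
Proof.
set A := Aset theta e; set e' := Srel theta e; set U := ~: A.
have UE : [set: T] :\: A = U by rewrite setTD.
have [|EU _ specU] := @del_all_special T R e theta e_sym e_irr [set: T] A.
  by move=> a; rewrite inE.
rewrite UE in EU specU.
have nospec x : ~~ special theta e U x.
  have [xA|xA] := boolP (x \in A); last by rewrite specU //; move: xA; rewrite inE.
  by rewrite /special inE xA.
have e'_sym : symmetric e'.
  by move=> x y; rewrite /e' /Srel /= e_sym eq_sym [(x \in _) || _]orbC.
have e'_irr : irreflexive e' by move=> x; rewrite /e' /Srel /= e_irr eqxx.
have mE (X : {set T}) : X \subset U -> mult theta e' X = mult theta e X.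
  move=> /subsetP sub; congr mup; apply: mpoly_ext => x y /sub + /sub.
  rewrite !in_setC => /negbTE xA /negbTE yA.
  by rewrite /e' /Srel /= -/A xA yA andbF orbF.
have univ (B : {set T}) : B \subset A -> forall a y, a \in B -> y != a -> e' a y.
  by move=> /subsetP sub a y /sub aA ya; rewrite /e' /Srel /= eq_sym ya -/A aA orbT.
have disU (B X : {set T}) : B \subset A -> X \subset U -> [disjoint B & X].
  move=> BA XU; apply: disjointWl BA _; apply: disjointWr XU _.
  by rewrite disjoint_sym disjoints_subset.
have TE : [set: T] = U :|: A by rewrite setUC setUCr.
(* Together with [EU] this shows that [e] and [e'] give the same multiplicity on the whole vertex
   set. *)
have ES : (mult theta e' [set: T] + #|A|)%N = mult theta e U.
  rewrite TE (mult_add_universal e'_sym e'_irr) ?mE ?disU //; first exact: univ.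
  by rewrite EU leq_addl.
(* If [x] is in [A], at most [#|A| - 1] vertices are added back to [U :\ y], whose multiplicity is
   at least that of [U] minus one; hence the multiplicity for [e'] does not drop at all. *)
have notA x y : x \in A ->
    (mult theta e' ([set: T] :\: [set x; y])).+2 <> mult theta e' [set: T].
  move=> xA.
  have -> : [set: T] :\: [set x; y] = (U :\ y) :|: (A :\ x :\ y).
    apply/setP => z; rewrite in_setD in_set2 in_setT andbT in_setU !in_setD1 in_setC.
    case: eqVneq => [->|_]; first by rewrite xA !andbF.
    by case: (z == y); case: (z \in A).
  have subU : U :\ y \subset U by rewrite subsetDl.
  have subA : A :\ x :\ y \subset A by rewrite setDDl subsetDl.
  have leA : (#|A :\ x :\ y| < #|A|)%N.
    by rewrite [X in (_ < X)%N](cardsD1 x A) xA ltnS subset_leq_card // subsetDl.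
  have leU : (mult theta e U <= (mult theta e (U :\ y)).+1)%N.
    have [yU|yU] := boolP (y \in U); first exact: mult_del_ge.
    by rewrite (_ : U :\ y = U) //; apply/setDidPl; rewrite disjoint_sym disjoints1.
  have := mult_add_ge theta e'_sym e'_irr (disU _ _ subA subU).
  by rewrite mE //; lia.
have [uA|uU] := boolP (u \in A).
  split=> [/(notA _ _ uA) //|[H1 [H2 [/andP [/exists_inP [x _ /eqP ->] _] _ _ + _]]]].
  by rewrite inE in_setC uA.
have [vA|vU] := boolP (v \in A).
  split=> [|[H1 [H2 [_ /andP [/exists_inP [x _ /eqP ->] _] _ _]]]].
    by rewrite setUC => /(notA _ _ vA).
  by rewrite inE in_setC vA.
have uU' : u \in U by rewrite inE.
have vU' : v \in U by rewrite inE.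
rewrite -(indep_critical e_sym e_irr nospec uU' vU' huv) /indep.
have sub : U :\ u :\ v \subset U by rewrite setDDl subsetDl.
have -> : [set: T] :\: [set u; v] = (U :\ u :\ v) :|: A.
  apply/setP => z; rewrite in_setD in_set2 in_setT andbT in_setU !in_setD1 in_setC negb_or.
  case: (eqVneq z u) => [->|_]; first by rewrite (negbTE uU) !andbF.
  by case: (eqVneq z v) => [->|_]; rewrite ?(negbTE vU) ?orNb.
split=> [E|/eqP E].
  have := mult_add_ge theta e'_sym e'_irr (disU _ _ (subxx A) sub).
  have := mult_del2_ge theta e_sym e_irr uU' vU' huv.
  by rewrite mE //; lia.
have := mult_add_universal (theta := theta) e'_sym e'_irr
  (disU _ _ (subxx A) sub) (univ A (subxx A)).
(* Here the assumption that [theta] has multiplicity at least 2 enters: with [EU] it leaves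
   [U :\ u :\ v] multiplicity at least [#|A|], so all of [A] can be added back with a drop at each
   vertex. *)
rewrite (mE _ sub) => H; have leA : (#|A| <= mult theta e (U :\ u :\ v))%N by lia.
by have := H leA; lia.
Qed.
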